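(* Let $D$ be a weakly locally finite division ring with center $F$. If for all $a,b\in D^*$ there is a positive integer $n$ with $(aba^{-1}b^{-1})^n\in F$, then $D$ is commutative.
   Context: A division ring $D$ is weakly locally finite if for every finite subset $S\subseteq D$, the division subring generated by $S$ is finite dimensional over its own center. *)

(* Defs.v *)
From HB Require Import structures.
From mathcomp Require Import all_boot all_order all_algebra.
Set Implicit Arguments. Unset Strict Implicit. Unset Printing Implicit Defensive.
Import GRing.Theory.
Local Open Scope ring_scope.

Definition is_division_ring (D : unitRingType) : Prop :=
  forall x : D, x != 0 -> x \is a GRing.unit.

Definition is_subdivring (D : unitRingType) (K : D -> Prop) : Prop :=
  [/\ K 1,
      (forall x y, K x -> K y -> K (x - y)),
      (forall x y, K x -> K y -> K (x * y)) &
      (forall x, K x -> x != 0 -> K x^-1)].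

Definition gen_divring (D : unitRingType) (S : seq D) : D -> Prop :=
  fun x => forall K : D -> Prop, is_subdivring K ->
             (forall s, s \in S -> K s) -> K x.

Definition center_of (D : unitRingType) (K : D -> Prop) : D -> Prop :=
  fun z => K z /\ forall y, K y -> z * y = y * z.

Definition fin_dim_over_center (D : unitRingType) (K : D -> Prop) : Prop :=
  exists l : seq D, (forall v, v \in l -> K v) /\
    forall x, K x -> exists c : seq D,
      [/\ size c = size l, (forall a, a \in c -> center_of K a) &
          x = \sum_(i < size l) c`_i * l`_i].

Definition weakly_locally_finite (D : unitRingType) : Prop :=
  forall S : seq D, fin_dim_over_center (gen_divring S).

Definition center (D : unitRingType) : D -> Prop := center_of (fun _ : D => True).

(* Main.v *)
Require Import Defs.
From HB Require Import structures.
From mathcomp Require Import all_boot all_order all_algebra all_field.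
From mathcomp Require Import boolp ring.
Set Implicit Arguments. Unset Strict Implicit. Unset Printing Implicit Defensive.
Import Order.TTheory GRing.Theory Num.Theory.
Local Open Scope ring_scope.

(* Suppose that x and y do not commute, and let K be the division subring that
   they generate, k its center and n = [K : k].  Represent K by matrices over k.
   A commutator has determinant 1, so if its m-th power is a scalar f then
   f ^ n = 1: all commutators of K have finite order.

   For t in k let c be the commutator of x and t - y.  Then
   (1 - c) (t - y) = x y x^-1 - y =: d does not depend on t, whence
   det (1 - c) * chi (t) = det d, where chi is the characteristic polynomial of
   y.  As c has finite order, det (1 - c) is integral over the integers.  So
   chi (t) / det d is algebraic over the prime field P for all t in k, and this
   forces k to be algebraic over P.  Hence some nonzero finite dimensional
   P-subspace of K is stable under left multiplication by x and y, and x and y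
   are represented by matrices over P.  If P is finite, Wedderburn's little
   theorem applies.  If P is the field of rationals, use the identity above
   over P: det (1 - c) is then a nonzero integer, so |chi (t)| <= |det d| for
   every integer t, which is absurd for a monic nonconstant polynomial. *)

(** * Splitting fields and determinants of matrices of finite order *)

Lemma irreducible_factor (F : fieldType) (p : {poly F}) :
  (1 < size p)%N -> exists2 q, irreducible_poly q & q %| p.
Proof.
move=> p_gt1.
(* A divisor of least size above 1 is irreducible. *)
pose P m := `[< exists q : {poly F}, [/\ size q = m, (1 < m)%N & q %| p] >].
have exP : exists m, P m by exists (size p); apply/asboolP; exists p.
case: (ex_minnP exP) => m /asboolP[q [szq m_gt1 q_dv_p]] min_m.
exists q => //; split; first by rewrite szq.
move=> r szr r_dv_q; have q_neq0 : q != 0 by rewrite -size_poly_gt0 szq ltnW.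
rewrite -dvdp_size_eqp // eqn_leq dvdp_leq //= szq; apply: min_m.
apply/asboolP; exists r; split=> //; last exact: dvdp_trans q_dv_p.
by rewrite ltn_neqAle eq_sym szr size_poly_gt0 (dvdpN0 r_dv_q).
Qed.

(** Adjoining a root of an irreducible factor splits off one linear factor. The quotient is smaller
    but lives over a larger field, so the induction is on the size with [F] generalised. *)
Lemma splitting_extension (F : fieldType) (p : {poly F}) : p \is monic ->
  exists (L : fieldType) (f : {rmorphism F -> L}) (rs : seq L),
    map_poly f p = \prod_(r <- rs) ('X - r%:P).
Proof.
move: {2}(size p) (leqnn (size p)) => n; elim: n => [|n IHn] in F p *.
  by rewrite size_poly_leq0 => /eqP-> /monic_neq0; rewrite eqxx.
move=> szp mon_p; have [p_gt1 | p_le1] := ltnP 1 (size p); last first.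
  exists F, idfun, [::]; rewrite big_nil map_poly_id //.
  by move: mon_p; rewrite (size1_polyC p_le1) monicE lead_coefC => /eqP->.
have [q irr_q q_dv_p] := irreducible_factor p_gt1.
have [K _ [z qz0 _]] := irredp_FAdjoin irr_q.
have pz0 : root (map_poly (in_alg K) p) z.
  by rewrite -(divpK q_dv_p) [map_poly _ _]rmorphM rootM qz0 orbT.
have /factor_theorem[s Ds] := pz0.
have mon_s : s \is monic.
  by rewrite -(monicMr _ (monicXsubC z)) -Ds map_monic.
have szs : (size s <= n)%N.
  rewrite -ltnS -[(size s).+1]addn1 (leq_trans _ szp) //.
  rewrite -(size_map_poly (in_alg K) p) Ds size_Mmonic ?monicXsubC ?monic_neq0 //.
  by rewrite size_XsubC addn2 addn1.
have [L [f [rs Drs]]] := IHn _ s szs mon_s.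
exists L, (f \o in_alg K), (rcons rs (f z)).
by rewrite map_poly_comp Ds rmorphM /= Drs map_polyXsubC -cats1 big_cat /= big_seq1.
Qed.

Lemma horner_char_poly (R : comNzRingType) n (A : 'M[R]_n) (t : R) :
  (char_poly A).[t] = \det (t%:M - A).
Proof.
rewrite -[_.[t]]/(horner_eval t _) -det_map_mx; congr (\det _).
by apply/matrixP => i j; rewrite !mxE /= /horner_eval !hornerE hornerMn hornerX.
Qed.

(* Every eigenvalue of a matrix of finite order is a root of unity. *)
Lemma integral_det_1sub (F : fieldType) n (C : 'M[F]_n.+1) k :
  (0 < k)%N -> C ^+ k = 1 -> integralOver (intr : int -> F) (\det (1 - C)).
Proof.
(* The determinant is the characteristic polynomial at 1, which in a splitting field is the product
   of [1 - r] over the eigenvalues [r]. *)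
move=> k_gt0 Ck1; rewrite -(horner_char_poly C 1).
have [L [f [rs Drs]]] := splitting_extension (char_poly_monic C).
suff [q mon_q q0] : integralOver (intr : int -> L) (f (char_poly C).[1]).
  exists q => //; move: q0; rewrite -(fmorph_root f) -map_poly_comp.
  by congr (root _ _); apply: eq_map_poly => i /=; rewrite rmorph_int.
rewrite -horner_map rmorph1 Drs horner_prod big_seq.
apply: big_ind => [||r rs_r]; [exact: integral1 | exact: integral_mul |].
rewrite !hornerE; apply: integral_sub; first exact: integral1.
exists ('X^k - 1); first by rewrite monicXnsubC.
have Cr : root (char_poly (map_mx f C)) r by rewrite -map_char_poly Drs root_prod_XsubC.
rewrite rmorphB rmorph1 /= map_polyXn.
have: mxminpoly (map_mx f C) %| 'X^k - 1.
  apply: mxminpoly_min; rewrite rmorphB rmorph1 rmorphXn /= horner_mx_X.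
  by rewrite -rmorphXn Ck1 rmorph1 subrr.
by move/root_dvdp; apply; rewrite ?root_mxminpoly.
Qed.

(** * Coordinates over a field acting on the left, and matrices of left multiplications *)

Section LinearCombinations.

Variables (D : unitRingType) (k : fieldType) (phi : {rmorphism k -> D}).

(** Scalars act through [phi], so restricting them to a subfield amounts to composing [phi] with an
    embedding. *)
Definition lincomb n (b : 'I_n -> D) (v : 'rV[k]_n) : D :=
  \sum_j phi (v 0 j) * b j.

Definition inspan n (b : 'I_n -> D) (z : D) := exists v, z = lincomb b v.

Definition linfree n (b : 'I_n -> D) := forall v, lincomb b v = 0 -> v = 0.

Lemma lincombD n (b : 'I_n -> D) u v :
  lincomb b (u + v) = lincomb b u + lincomb b v.
Proof.
by rewrite -big_split; apply: eq_bigr => j _; rewrite mxE rmorphD mulrDl.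
Qed.

Lemma lincombZ n (b : 'I_n -> D) a v :
  lincomb b (a *: v) = phi a * lincomb b v.
Proof.
by rewrite mulr_sumr; apply: eq_bigr => j _; rewrite mxE rmorphM mulrA.
Qed.

Lemma lincomb0 n (b : 'I_n -> D) : lincomb b 0 = 0.
Proof. by rewrite -(scale0r 0) lincombZ rmorph0 mul0r. Qed.

Lemma lincombN n (b : 'I_n -> D) v : lincomb b (- v) = - lincomb b v.
Proof. by rewrite -scaleN1r lincombZ rmorphN1 mulN1r. Qed.

Lemma lincomb_delta n (b : 'I_n -> D) i : lincomb b (delta_mx 0 i) = b i.
Proof.
rewrite /lincomb (bigD1 i) //= big1 ?addr0 => [|j ji].
  by rewrite mxE !eqxx rmorph1 mul1r.
by rewrite mxE (negPf ji) andbF rmorph0 mul0r.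
Qed.

Lemma lincomb_inj n (b : 'I_n -> D) : linfree b -> injective (lincomb b).
Proof.
move=> fb u v /eqP; rewrite -subr_eq0 -lincombN -lincombD => /eqP/fb/eqP.
by rewrite subr_eq0 => /eqP.
Qed.

Lemma inspan0 n (b : 'I_n -> D) : inspan b 0.
Proof. by exists 0; rewrite lincomb0. Qed.

Lemma inspanD n (b : 'I_n -> D) y z : inspan b y -> inspan b z -> inspan b (y + z).
Proof. by move=> [u ->] [v ->]; exists (u + v); rewrite lincombD. Qed.

Lemma inspanZ n (b : 'I_n -> D) a z : inspan b z -> inspan b (phi a * z).
Proof. by case=> v ->; exists (a *: v); rewrite lincombZ. Qed.

Lemma inspan_sum n (b : 'I_n -> D) (I : Type) (r : seq I) (P : pred I) (f : I -> D) :
  (forall i, P i -> inspan b (f i)) -> inspan b (\sum_(i <- r | P i) f i).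
Proof.
by move=> bf; apply: big_ind => //; [exact: inspan0 | exact: inspanD].
Qed.

Lemma inspan_gen n (b : 'I_n -> D) i : inspan b (b i).
Proof. by exists (delta_mx 0 i); rewrite lincomb_delta. Qed.

Lemma inspan_sub n (b : 'I_n -> D) m (b' : 'I_m -> D) z :
  (forall i, inspan b' (b i)) -> inspan b z -> inspan b' z.
Proof. by move=> bb' [v ->]; apply: inspan_sum => i _; apply/inspanZ/bb'. Qed.

Lemma lincomb_recl n (b : 'I_n.+1 -> D) (v : 'rV_n.+1) :
  lincomb b v = phi (v 0 ord0) * b ord0
     + lincomb (b \o lift ord0) (\row_j v 0 (lift ord0 j)).
Proof.
rewrite /lincomb big_ord_recl; congr (_ + _).
by apply: eq_bigr => j _; rewrite mxE.
Qed.

(** By induction, [b ord0] is dropped if it lies in the span of the other vectors and prepended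
    otherwise. *)
Lemma exists_linfree n (b : 'I_n -> D) : exists m (b' : 'I_m -> D),
  linfree b' /\ forall z, inspan b z <-> inspan b' z.
Proof.
elim: n b => [|n IHn] b.
  by exists 0, b; split=> // v _; rewrite thinmx0.
have [m [b' [fb' bb']]] := IHn (b \o lift ord0).
have [b0 | b0] := EM (inspan b' (b ord0)).
  exists m, b'; split=> // z; split.
    apply: inspan_sub => i; case: (unliftP ord0 i) => [j|] -> //.
    by apply/bb'; apply: (inspan_gen (b \o lift ord0)).
  move/bb'; apply: inspan_sub => i; exact: inspan_gen.
pose b1 (i : 'I_m.+1) := if unlift ord0 i is Some j then b' j else b ord0.
have b1l : b1 \o lift ord0 = b' by apply/funext => j; rewrite /b1 /= liftK.
have b10 : b1 ord0 = b ord0 by rewrite /b1 unlift_none.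
exists m.+1, b1; split=> [v | z].
  rewrite lincomb_recl b1l b10 => v0.
  have v00 : v 0 ord0 = 0.
    apply/eqP/negP => /negP nz; case: b0.
    exists (- (v 0 ord0)^-1 *: \row_j v 0 (lift ord0 j)).
    rewrite lincombZ -[b ord0](mulKr (_ : phi (v 0 ord0) \is a GRing.unit)).
      rewrite -fmorphV rmorphN mulNr -mulrN; congr (_ * _).
      by apply/eqP; rewrite -addr_eq0 v0.
    by rewrite rmorph_unit // unitfE.
  rewrite v00 rmorph0 mul0r add0r in v0; have v'0 := fb' _ v0.
  apply/rowP=> i; rewrite mxE; case: (unliftP ord0 i) => [j|] -> //.
  by have /rowP/(_ j) := v'0; rewrite !mxE.
split; apply: inspan_sub => i; case: (unliftP ord0 i) => [j|] ->.
- have /bb' : inspan (b \o lift ord0) (b (lift ord0 j)).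
    exact: (inspan_gen (b \o lift ord0)).
  rewrite -b1l; apply: inspan_sub => l; exact: (inspan_gen b1).
- rewrite -b10; exact: inspan_gen.
- rewrite -[b1 _]/((b1 \o lift ord0) j) b1l.
  have /bb' : inspan b' (b' j) by exact: inspan_gen.
  by apply: inspan_sub => l; exact: inspan_gen.
- rewrite b10; exact: inspan_gen.
Qed.

(** Coordinates are rows and [M] acts on their right, so products are represented in reverse order.
    Determinants do not see the reversal. *)
Definition represents n (b : 'I_n -> D) (x : D) (M : 'M[k]_n) :=
  forall v, x * lincomb b v = lincomb b (v *m M).

Lemma represents_exists n (b : 'I_n -> D) x :
  (forall a, x * phi a = phi a * x) -> (forall i, inspan b (x * b i)) ->
  exists M, represents b x M.
Proof.
move=> cx /fin_all_exists[f Df]; exists (\matrix_i f i) => v.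
rewrite mulr_sumr mulmx_sum_row.
rewrite (big_morph (lincomb b) (@lincombD _ b) (lincomb0 b)).
by apply: eq_bigr => i _; rewrite rowK lincombZ -Df !mulrA cx.
Qed.

Section Represents.

Variables (n : nat) (b : 'I_n.+1 -> D).

Lemma represents_scal a : represents b (phi a) a%:M.
Proof. by move=> v; rewrite mul_mx_scalar lincombZ. Qed.

Lemma represents1 : represents b 1 1.
Proof. by rewrite -(rmorph1 phi); apply: represents_scal. Qed.

Lemma represents0 : represents b 0 0.
Proof. by move=> v; rewrite mul0r mulmx0 lincomb0. Qed.

Lemma representsB x y M N :
  represents b x M -> represents b y N -> represents b (x - y) (M - N).
Proof.
by move=> xM yN v; rewrite mulrBl mulmxBr lincombD lincombN xM yN.
Qed.

Lemma representsM x y M N :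
  represents b x M -> represents b y N -> represents b (x * y) (N * M).
Proof. by move=> xM yN v; rewrite -mulrA yN xM mulmxA. Qed.

Lemma representsX x M m : represents b x M -> represents b (x ^+ m) (M ^+ m).
Proof.
move=> xM; elim: m => [|m IHm]; first exact: represents1.
by rewrite exprSr exprS; apply: representsM.
Qed.

Hypotheses (divD : is_division_ring D) (free_b : linfree b).

Lemma represents_inj x M N : represents b x M -> represents b x N -> M = N.
Proof.
move=> xM xN; apply/row_matrixP => i; rewrite !rowE.
by apply: (lincomb_inj free_b); rewrite -xM -xN.
Qed.

(** Both elements act alike on [b ord0], a unit; the index [n.+1] guarantees that this vector
    exists. *)
Lemma represents_faithful x y M : represents b x M -> represents b y M -> x = y.
Proof.
move=> xM yM; have b0 : b ord0 \is a GRing.unit.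
  apply: divD; apply/eqP => b0; have := lincomb_delta b ord0.
  rewrite b0 => /free_b/rowP/(_ ord0)/eqP.
  by rewrite !mxE !eqxx oner_eq0.
by apply: (mulIr b0); rewrite -[b _]lincomb_delta xM yM.
Qed.

(** A row killed by [M] gives the coordinates of an element killed by the unit [x], so it is zero by
    freeness. *)
Lemma represents_unit x M : represents b x M -> x != 0 -> M \is a GRing.unit.
Proof.
move=> xM x0; suff: M \in unitmx by [].
rewrite -row_free_unit -kermx_eq0; apply/eqP/row_matrixP => i.
have: row i (kermx M) *m M = 0 by rewrite -row_mul mulmx_ker row0.
set v := row i _ => vM; rewrite row0; apply: free_b.
by apply: (mulrI (divD x0)); rewrite xM vM lincomb0 mulr0.
Qed.

Lemma representsV x M : represents b x M -> x != 0 -> represents b x^-1 M^-1.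
Proof.
move=> xM x0 v; have uM := represents_unit xM x0.
apply: (mulrI (divD x0)); rewrite mulrA mulrV ?divD // mul1r xM -mulmxA.
by rewrite -[_ *m M]/(_ * M) mulVr // mulmx1.
Qed.

Lemma represents_det_neq0 x M : represents b x M -> x != 0 -> \det M != 0.
Proof. by move=> xM x0; rewrite -unitfE -unitmxE (represents_unit xM x0). Qed.

Lemma represents_commutator_det x y M N :
  represents b x M -> represents b y N -> x != 0 -> y != 0 ->
  exists2 C, represents b (x * y * x^-1 * y^-1) C & \det C = 1.
Proof.
move=> xM yN x0 y0; exists (N^-1 * (M^-1 * (N * M))).
  by do !apply: representsM => //; apply: representsV.
rewrite !det_mulmx !det_inv mulrCA mulKf ?mulVf //.
  exact: represents_det_neq0 xM x0.
exact: represents_det_neq0 yN y0.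
Qed.

End Represents.

End LinearCombinations.

(** * Algebraic elements: as [P] is a field, integral over [phi] means algebraic *)

Section AlgebraicElements.

Variables (P F : fieldType) (phi : {rmorphism P -> F}).

Lemma integral_over_int (z : F) :
  integralOver (intr : int -> F) z -> integralOver phi z.
Proof.
case=> q mon_q qz; exists (map_poly intr q); first exact: monic_map.
rewrite -map_poly_comp; move: qz; congr (root _ _).
by apply: eq_map_poly => i /=; rewrite rmorph_int.
Qed.

(** Newton interpolation: the divided difference [h] of [g] at [t] takes algebraic values at the
    remaining points, so induction applies to it. *)
Lemma integral_coef_interpolation (s : seq F) (g : {poly F}) :
  uniq s -> (size g <= size s)%N ->
  {in s, forall t, integralOver phi t /\ integralOver phi g.[t]} ->
  forall i, integralOver phi g`_i.
Proof.
elim: s g => [|t s IHs] g /=.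
  by move=> _; rewrite size_poly_leq0 => /eqP-> _ i; rewrite coef0; apply: integral0.
case/andP=> t_notin_s uniq_s szg ints.
have [intt intgt] := ints t (mem_head t s).
have /factor_theorem[h Dh] : root (g - g.[t]%:P) t by rewrite rootE !hornerE subrr.
have Dg : g = h * ('X - t%:P) + g.[t]%:P by rewrite -Dh subrK.
have inth i : integralOver phi h`_i.
  apply: IHs => // [|r s_r].
    have [->|h0] := eqVneq h 0; first by rewrite size_poly0.
    have: (size (g - g.[t]%:P)%R <= (size s).+1)%N.
      rewrite (leq_trans (size_polyD _ _)) // geq_max szg size_polyN.
      by rewrite (leq_trans (size_polyC_leq1 _)).
    by rewrite Dh size_Mmonic ?monicXsubC // size_XsubC addn2.
  have [|intr intgr] := ints r; first by rewrite inE s_r orbT.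
  split=> //; have rt : r - t != 0 by rewrite subr_eq0; apply: contraNneq t_notin_s => <-.
  have -> : h.[r] = (g.[r] - g.[t]) / (r - t) by rewrite {1}Dg !hornerE addrK mulfK.
  by apply: integral_div; apply: integral_sub.
move=> i; rewrite Dg mulrBr coefD coefB coefMX coefMC coefC.
apply: integral_add; last by case: ifP => // _; apply: integral0.
apply: integral_sub; last exact: integral_mul.
by case: ifP => // _; apply: integral0.
Qed.

(* If infinitely many elements are integral, [g] has integral coefficients and
   [t] is a root of [g - g.[t]]; otherwise [g] takes finitely many values, so
   that the powers of [t] cannot be distinct. *)
Lemma integral_of_values (g : {poly F}) : (1 < size g)%N ->
  (forall t, integralOver phi g.[t]) -> forall t, integralOver phi t.
Proof.
move=> szg intg t.
(* Sets of algebraic elements are capped at [size g]: a largest one then exists, and reaching the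
   cap gives enough interpolation points. *)
pose Q m := `[< exists s : seq F, [/\ uniq s, size s = m, (m <= size g)%N &
  {in s, forall r, integralOver phi r}] >].
have exQ : exists m, Q m by exists 0; apply/asboolP; exists [::].
have ubQ m : Q m -> (m <= size g)%N by move/asboolP=> [s [_ _ ->]].
case: (ex_maxnP exQ ubQ) => m /asboolP[s [uniq_s szs le_m ints]] max_m.
have [lt_m | ge_m] := ltnP m (size g); last first.
  have intc : forall i, integralOver phi g`_i.
    apply: (integral_coef_interpolation uniq_s); first by rewrite szs.
    by move=> r /ints.
  apply: (@integral_root _ _ phi (g - g.[t]%:P)).
  - apply: contraTneq szg => /eqP; rewrite subr_eq0 => /eqP->.
    by rewrite size_polyC; case: (_ == _).
  - by rewrite rootE !hornerE subrr.
  apply/integral_poly => i; rewrite coefB coefC; apply: integral_sub => //.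
  by case: ifP => // _; apply: integral0.
have s_all r : integralOver phi r -> r \in s.
  move=> intr; apply: contraTT lt_m => r_notin_s; rewrite -leqNgt.
  have [//|lt_m] := leqP (size g) m.
  have: (m.+1 <= m)%N; last by rewrite ltnn.
  apply: max_m; apply/asboolP; exists (r :: s); rewrite /= r_notin_s szs.
  by split=> // r'; rewrite inE => /predU1P[-> //|/ints].
(* For every [r] the value [g.[r]] is algebraic, hence in [s], so [q] vanishes on all of [F]. *)
pose q := \prod_(r <- s) (g - r%:P).
have q0 : q != 0.
  rewrite prodf_seq_neq0; apply/allP => r _ /=.
  apply: contraTneq szg => /eqP; rewrite subr_eq0 => /eqP->.
  by rewrite size_polyC; case: (_ == _).
have qr r : root q r.
  rewrite /root horner_prod prodf_seq_eq0; apply/hasP.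
  by exists g.[r]; [exact: s_all | rewrite !hornerE subrr eqxx].
apply: contrapT => not_int_t.
have inj_t : injective (fun i => t ^+ i).
  have lt_inj i j : (i < j)%N -> t ^+ i != t ^+ j.
    move=> lt_ij; apply: contra_notN not_int_t => /eqP tij.
    exists ('X^j - 'X^i).
      rewrite monicE lead_coefDl ?lead_coefXn // size_opp !size_polyXn; exact: lt_ij.
    by rewrite rmorphB /= !map_polyXn rootE !hornerE tij subrr.
  move=> i j /eqP; case: (ltngtP i j) => // [/lt_inj/negPf-> // | /lt_inj].
  by rewrite eq_sym => /negPf->.
have := max_poly_roots q0 (rs := [seq t ^+ i | i <- iota 0 (size q)]).
rewrite size_map size_iota ltnn => absurd; apply: notF; apply: absurd.
  by apply/allP => r _.
by rewrite map_inj_uniq ?iota_uniq.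
Qed.

(** Elements are adjoined one at a time: the generators are multiplied by the powers of [c] below
    the degree of a monic polynomial killing [c]. The family need not be free. *)
Lemma stable_span (cs : seq F) : {in cs, forall c, integralOver phi c} ->
  exists m (e : 'I_m -> F), (exists i, e i != 0) /\
    {in cs, forall c i, inspan phi e (c * e i)}.
Proof.
elim: cs => [|c cs IHcs] intcs.
  by exists 1, (fun=> 1); split=> //; exists ord0; rewrite oner_eq0.
have [c' cs_c'|m [e [[i0 ei0] stab_e]]] := IHcs.
  by apply: intcs; rewrite inE cs_c' orbT.
have [p mon_p pc] := intcs c (mem_head c cs).
pose d := (size p).-1; have p0 := monic_neq0 mon_p.
have Dd : size p = d.+1 by rewrite /d prednK // size_poly_gt0.
have d_gt0 : (0 < d)%N.
  rewrite lt0n; apply: contraTneq pc => d0.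
  move: mon_p; rewrite (size1_polyC (_ : size p <= 1)%N) ?Dd ?d0 //.
  by rewrite monicE lead_coefC => /eqP->; rewrite map_polyC /= rmorph1 root1.
pose I := ('I_m * 'I_d)%type.
pose e' (i : 'I_#|{: I}|) := e (enum_val i).1 * c ^+ (enum_val i).2.
have e'M i j : inspan phi e' (e i * c ^+ j).
  (* Reduction modulo [p] leaves only powers of [c] below [d]. *)
  have -> : c ^+ j = (map_poly phi ('X^j %% p)).[c].
    rewrite -[c ^+ j](hornerXn c j) -(map_polyXn phi) {1}(divp_eq 'X^j p).
    by rewrite rmorphD rmorphM /= hornerD hornerM (rootP pc) mulr0 add0r.
  rewrite horner_coef size_map_poly mulr_sumr; apply: inspan_sum => l _.
  rewrite coef_map mulrCA; apply: inspanZ.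
  have lt_l : (l < d)%N.
    by rewrite (leq_trans (ltn_ord l)) // -ltnS -Dd ltn_modp.
  rewrite (_ : _ * _ = e' (enum_rank (i, Ordinal lt_l))); first exact: inspan_gen.
  by rewrite /e' enum_rankK.
exists #|{: I}|, e'; split.
  exists (enum_rank (i0, Ordinal d_gt0)).
  by rewrite /e' enum_rankK /= expr0 mulr1.
move=> c'; rewrite inE => /predU1P[-> i | cs_c' i].
  by rewrite /e' mulrCA -exprS.
have [v Dv] := stab_e c' cs_c' (enum_val i).1.
rewrite /e' mulrA Dv mulr_suml; apply: inspan_sum => l _.
by rewrite -mulrA; apply: inspanZ.
Qed.

End AlgebraicElements.

(** * Embedding of the prime field *)

Section RationalPrimeField.

Variable F : fieldType.
Hypothesis char0F : has_pchar0 F.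

Let intr_neq0 (m : int) : m != 0 -> m%:~R != 0 :> F.
Proof.
have nat_neq0 n : n != 0%N -> n%:R != 0 :> F by rewrite (proj1 (pcharf0P F) char0F).
case: m => [n | n] m0; first exact: nat_neq0.
by rewrite NegzE rmorphN /= oppr_eq0; apply: nat_neq0.
Qed.

(** [ratr] is defined on the reduced fraction. Cross-multiplication, valid in characteristic 0,
    allows any fraction and turns the morphism laws into field identities. *)
Let ratr_frac (m n : int) : n != 0 -> ratr (m%:~R / n%:~R) = m%:~R / n%:~R :> F.
Proof.
move=> n0; set q : rat := _ / _.
apply/eqP; rewrite eqr_div ?intr_neq0 ?denq_neq0 // -!rmorphM /=.
suff -> : numq q * n = m * denq q by [].
apply/eqP; rewrite -(eqr_int rat) !rmorphM /= numqE -mulrA mulrCA mulrC.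
by rewrite divfK // intr_eq0.
Qed.

Let ratr_zmod_morphism : zmod_morphism (@ratr F).
Proof.
move=> x y; rewrite -[x]divq_num_den -[y]divq_num_den.
have dx := denq_neq0 x; have dy := denq_neq0 y.
have -> : (numq x)%:~R / (denq x)%:~R - (numq y)%:~R / (denq y)%:~R =
   (numq x * denq y - numq y * denq x)%:~R / (denq x * denq y)%:~R :> rat.
  by rewrite rmorphB !rmorphM /=; field; rewrite !intr_eq0 dx dy.
rewrite !ratr_frac ?mulf_neq0 // rmorphB !rmorphM /=.
by field; rewrite !intr_neq0.
Qed.

Let ratr_monoid_morphism : monoid_morphism (@ratr F).
Proof.
split=> [|x y]; first by rewrite /ratr divr1.
rewrite -[x]divq_num_den -[y]divq_num_den.
have dx := denq_neq0 x; have dy := denq_neq0 y.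
rewrite mulf_div -!rmorphM !ratr_frac ?mulf_neq0 // !rmorphM /=.
by field; rewrite !intr_neq0.
Qed.

Lemma rat_rmorphism : inhabited {rmorphism rat -> F}.
Proof.
pose zM := GRing.isZmodMorphism.Build rat F (@ratr F) ratr_zmod_morphism.
pose mM := GRing.isMonoidMorphism.Build rat F (@ratr F) ratr_monoid_morphism.
pose phi : {rmorphism rat -> F} := HB.pack (@ratr F) zM mM.
exact: (inhabits phi).
Qed.

End RationalPrimeField.

Lemma prime_field_rmorphism (F : fieldType) :
  (exists p, inhabited {rmorphism 'F_p -> F}) \/ inhabited {rmorphism rat -> F}.
Proof.
have [[p pcharFp]|pchar0] := EM (exists p, p \in [pchar F]).
  pose phi : {rmorphism 'F_p -> pPrimeCharType pcharFp} := in_alg _.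
  by left; exists p; apply: (inhabits phi).
right; apply: rat_rmorphism => p.
by apply/negP => pcharFp; case: pchar0; exists p.
Qed.

(** * Integral rationals and growth of rational polynomials *)

(** A rational algebraic integer is an integer, which is read off in [algC]. *)
Lemma integral_rat_norm_ge1 (w : rat) :
  integralOver (intr : int -> rat) w -> w != 0 -> 1 <= `|w|.
Proof.
case=> q mon_q qw0 w0.
have : ratr w \is a @Num.int algC.
  apply: Cint_rat_Aint; first exact: Crat_rat.
  apply: (@root_monic_Aint (map_poly intr q)).
  - have -> : map_poly (intr : int -> algC) q = map_poly ratr (map_poly intr q).
      by rewrite -map_poly_comp; apply: eq_map_poly => i /=; rewrite ratr_int.
    by rewrite fmorph_root.
  - exact: monic_map.
  - by apply/polyOverP => i; rewrite coef_map /= intr_int.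
move/norm_intr_ge1; rewrite fmorph_eq0 => /(_ w0).
by rewrite -ratr_norm -(rmorph1 (ratr : rat -> algC)) ler_rat.
Qed.

(** A uniform bound [e] makes the induction work: [p * 'X + c] is at least [e * n + c], which
    reaches 1 once [n] is at least [(1 + |c|) / e]. *)
Lemma poly_rat_eventually_ge (p : {poly rat}) : 0 < lead_coef p ->
  exists2 e : rat, 0 < e & exists N, forall n, (N <= n)%N -> e <= p.[n%:R].
Proof.
elim/poly_ind: p => [|p c IHp]; first by rewrite lead_coef0 ltxx.
have [-> | p0] := eqVneq p 0.
  rewrite mul0r add0r lead_coefC => c_gt0; exists c => //; exists 0 => n _.
  by rewrite hornerC.
rewrite lead_coefDl ?lead_coefMX; last first.
  by rewrite size_mulX // (leq_ltn_trans (size_polyC_leq1 _)) // ltnS size_poly_gt0.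
case/IHp=> e e_gt0 [N leN]; exists 1 => //.
exists (maxn N (Num.bound ((1 + `|c|) / e))) => n; rewrite geq_max => /andP[Nn ln].
rewrite hornerMXaddC; apply: (@le_trans _ _ (e * n%:R + c)); last first.
  by rewrite lerD2r ler_wpM2r // ?ler0n // leN.
rewrite -lerBlDr mulrC -ler_pdivrMr //.
apply: (@le_trans _ _ ((1 + `|c|) / e)).
  by rewrite ler_pM2r ?invr_gt0 // lerD2l -normrN ler_norm.
apply/ltW/(lt_le_trans (archi_boundP _)); last by rewrite ler_nat.
by rewrite divr_ge0 ?(ltW e_gt0) // addr_ge0.
Qed.

Lemma poly_rat_unbounded (p : {poly rat}) (C : rat) :
  p \is monic -> (1 < size p)%N -> exists n : nat, C < p.[n%:R].
Proof.
move=> mon_p szp; have: 0 < lead_coef (p - C%:P).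
  rewrite lead_coefDl ?(monicP mon_p) // size_polyN.
  exact: leq_ltn_trans (size_polyC_leq1 _) szp.
case/poly_rat_eventually_ge => e e_gt0 [N leN]; exists N.
have := lt_le_trans e_gt0 (leN N (leqnn N)).
by rewrite !hornerE subr_gt0.
Qed.

(** * Commutators, and descent of the scalars to a subfield *)

Section MatrixDivisionRing.

Variables (D : unitRingType) (k : fieldType) (phi : {rmorphism k -> D}).
Variables (n : nat) (b : 'I_n.+1 -> D).
Hypotheses (divD : is_division_ring D) (free_b : linfree phi b).

Lemma commutator_torsion x y M N m f :
  represents phi b x M -> represents phi b y N -> x != 0 -> y != 0 ->
  (0 < m)%N -> (x * y * x^-1 * y^-1) ^+ m = phi f ->
  exists2 l, (0 < l)%N & (x * y * x^-1 * y^-1) ^+ l = 1.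
Proof.
move=> xM yN x0 y0 m_gt0 cm.
have [C cC detC] := represents_commutator_det divD free_b xM yN x0 y0.
(* [C] has determinant 1 and [C ^+ m] is the scalar matrix of [f], so [f ^+ n.+1 = 1]. *)
exists (m * n.+1)%N; first by rewrite muln_gt0 m_gt0.
have Cm : C ^+ m = f%:M.
  apply: (represents_inj free_b (representsX m cC)).
  by rewrite cm; apply: represents_scal.
rewrite exprM cm -rmorphXn -det_scalar -Cm.
suff -> : \det (C ^+ m) = 1 by rewrite rmorph1.
elim: m {m_gt0 cm Cm} => [|m IHm]; first by rewrite expr0 det1.
by rewrite exprS det_mulmx detC IHm mul1r.
Qed.

(* With [c] the commutator of [a] and [phi t - y] one has
   [(1 - c) * (phi t - y) = a * y * a^-1 - y], independently of [t]. *)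
Lemma char_poly_values a y A B :
  represents phi b a A -> represents phi b y B -> a * y != y * a ->
  exists2 delta, delta != 0 & forall t, a * phi t = phi t * a ->
    (exists2 m, (0 < m)%N & (a * (phi t - y) * a^-1 * (phi t - y)^-1) ^+ m = 1) ->
  exists2 w, integralOver (intr : int -> k) w & w * (char_poly B).[t] = delta.
Proof.
move=> aA yB nc.
have a0 : a != 0 by apply: contraNneq nc => ->; rewrite mul0r mulr0.
have ua := divD a0.
pose d := a * y * a^-1 - y.
have d0 : d != 0.
  apply: contra nc; rewrite subr_eq0 => /eqP yE.
  by rewrite -{2}yE mulrVK.
have dN : represents phi b d (A^-1 * (B * A) - B).
  apply: representsB => //; apply: representsM; first exact: representsM.
  exact: representsV.
exists (\det (A^-1 * (B * A) - B)) => [|t at_ [m m_gt0]].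
  exact: represents_det_neq0 dN d0.
set z := phi t - y => cm1.
have z0 : z != 0.
  by apply: contra nc; rewrite subr_eq0 => /eqP<-; rewrite at_.
have zZ : represents phi b z (t%:M - B).
  by apply: representsB => //; apply: represents_scal.
have [C cC _] := represents_commutator_det divD free_b aA zZ a0 z0.
have Cm1 : C ^+ m = 1.
  apply: (represents_inj free_b (representsX m cC)).
  by rewrite cm1; apply: represents1.
exists (\det (1 - C)); first exact: integral_det_1sub m_gt0 Cm1.
(* [mulrC] matches the reversed order in which the matrices represent [(1 - c) * z]. *)
rewrite horner_char_poly mulrC -det_mulmx; congr (\det _).
apply: (represents_inj free_b (representsM (representsB (represents1 _ b) cC) zZ)).
rewrite mulrBl mul1r mulrVK ?divD // {1}/z mulrBr mulrBl at_ mulrK //.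
by rewrite opprB addrC addrA subrK.
Qed.

(** The entries of [M] and [N] are algebraic over [P], so they stabilise the [P]-span of some finite
    family [e] in [k]. The products [phi (e i) * b j] then have a [P]-span stable under [x] and
    [y]. *)
Lemma descend_basis (P : fieldType) (iota : {rmorphism P -> k}) x y M N :
  (forall t, integralOver iota t) ->
  (forall t, x * phi t = phi t * x) -> (forall t, y * phi t = phi t * y) ->
  represents phi b x M -> represents phi b y N ->
  exists m (e : 'I_m.+1 -> D), linfree (phi \o iota) e /\
   ((exists M', represents (phi \o iota) e x M') /\
    (exists N', represents (phi \o iota) e y N')).
Proof.
move=> algk cx cy xM yN.
pose cs := [seq M p.1 p.2 | p : 'I_n.+1 * 'I_n.+1]
        ++ [seq N p.1 p.2 | p : 'I_n.+1 * 'I_n.+1].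
have [|m [e [[i0 ei0] stab_e]]] := @stable_span _ _ iota cs.
  by move=> t _; apply: algk.
pose I := ('I_m * 'I_n.+1)%type.
pose g (i : 'I_#|{: I}|) := phi (e (enum_val i).1) * b (enum_val i).2.
have gE i j : inspan (phi \o iota) g (phi (e i) * b j).
  rewrite (_ : _ * _ = g (enum_rank (i, j))); first exact: inspan_gen.
  by rewrite /g enum_rankK.
have stab z Z : (forall t, z * phi t = phi t * z) -> represents phi b z Z ->
    (forall i j, Z i j \in cs) -> forall i, inspan (phi \o iota) g (z * g i).
  move=> cz zZ csZ i; rewrite /g; case: (enum_val i) => {}i j /=.
  rewrite mulrA cz -mulrA -[b j](lincomb_delta phi b) zZ -rowE mulr_sumr.
  apply: inspan_sum => l _; rewrite mulrA -rmorphM mxE mulrC.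
  have [v ->] := stab_e _ (csZ j l) i; rewrite rmorph_sum mulr_suml.
  apply: inspan_sum => h _; rewrite rmorphM -mulrA.
  exact: (inspanZ (phi := phi \o iota)).
(* The free family is nonempty because [phi (e i0) * b ord0] is nonzero. *)
have [[|m'] [g' [free_g' gg']]] := exists_linfree (phi \o iota) g.
  have /gg'[v] := gE i0 ord0; rewrite /lincomb big_ord0 => eb0.
  have: b ord0 = 0.
    apply: (mulrI (_ : phi (e i0) \is a GRing.unit)); last by rewrite eb0 mulr0.
    by rewrite rmorph_unit ?unitfE.
  rewrite -(lincomb_delta phi b) => /free_b/rowP/(_ ord0)/eqP.
  by rewrite !mxE !eqxx oner_eq0.
exists m', g'; split=> //.
have rep z Z : (forall t, z * phi t = phi t * z) -> represents phi b z Z ->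
    (forall i j, Z i j \in cs) -> exists Z', represents (phi \o iota) g' z Z'.
  move=> cz zZ csZ; apply: represents_exists => [t | i]; first exact: cz.
  have /gg'[v ->] : inspan (phi \o iota) g' (g' i) by exact: inspan_gen.
  apply/gg'; rewrite mulr_sumr; apply: inspan_sum => j _.
  rewrite mulrA cz -mulrA; apply: (inspanZ (phi := phi \o iota)).
  exact: stab zZ csZ j.
split; [apply: rep xM _ | apply: rep yN _] => // i j; rewrite mem_cat.
  by apply/orP; left; apply/imageP; exists (i, j).
by apply/orP; right; apply/imageP; exists (i, j).
Qed.

End MatrixDivisionRing.

(** * Finite scalars *)

Section FiniteCase.

Variables (D : unitRingType) (k : finFieldType) (phi : {rmorphism k -> D}).
Variables (n : nat) (b : 'I_n.+1 -> D).
Hypotheses (divD : is_division_ring D) (free_b : linfree phi b).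

(** The ring is carried by matrices rather than by elements of [D], since matrices over [k] form a
    finite type. *)
Definition representing : {pred 'M[k]_n.+1} :=
  fun M => `[< exists x, represents phi b x M >].

Fact representing_divring_closed : divring_closed representing.
Proof.
split=> [|M N /asboolP[x xM] /asboolP[y yN]|M N /asboolP[x xM] /asboolP[y yN]].
- by apply/asboolP; exists 1; apply: represents1.
- by apply/asboolP; exists (x - y); apply: representsB.
(* If [y] is zero then so is [N], and [M / N] is 0 by the convention on inverses; otherwise it
   represents [y^-1 * x]. *)
apply/asboolP; have [y0 | y0] := eqVneq y 0.
  exists 0; rewrite (_ : M / N = 0); first exact: represents0.
  rewrite y0 in yN; rewrite (represents_inj free_b yN (represents0 _ b)).
  by rewrite invr0 mulr0.
by exists (y^-1 * x); apply: representsM => //; apply: representsV.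
Qed.

HB.instance Definition _ :=
  GRing.isDivringClosed.Build 'M[k]_n.+1 representing representing_divring_closed.

Record representing_matrix :=
  RepresentingMatrix {rmval : 'M[k]_n.+1; _ : rmval \in representing}.

HB.instance Definition _ := [isSub for rmval].
HB.instance Definition _ := [Finite of representing_matrix by <:].
HB.instance Definition _ := [SubChoice_isSubUnitRing of representing_matrix by <:].

Lemma representing_domain : GRing.integral_domain_axiom representing_matrix.
Proof.
case=> M hM [N hN] /(congr1 val) /= MN0.
have /asboolP[x xM] := hM; have /asboolP[y yN] := hN.
suff: (M == 0) || (N == 0) by [].
have [// | M0 /=] := eqVneq M 0.
have x0 : x != 0.
  apply: contraNneq M0 => x0; rewrite x0 in xM.
  exact/eqP/(represents_inj free_b xM)/represents0.
have uM := represents_unit divD free_b xM x0.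
by apply/eqP/(mulrI uM); rewrite mulr0.
Qed.

(* Wedderburn's little theorem, applied to the matrices representing an element. *)
Lemma represents_finite_comm x y M N :
  represents phi b x M -> represents phi b y N -> x * y = y * x.
Proof.
move=> xM yN.
have hM : M \in representing by apply/asboolP; exists x.
have hN : N \in representing by apply/asboolP; exists y.
have := finDomain_mulrC representing_domain (RepresentingMatrix hM) (RepresentingMatrix hN).
move/(congr1 val) => /= MN.
apply: (represents_faithful divD free_b (representsM xM yN)).
by rewrite -MN; apply: representsM.
Qed.

End FiniteCase.

(** * The center of a division subring as a field of scalars *)

Section CenterField.

Variables (D : unitRingType) (K : D -> Prop).
Hypotheses (divD : is_division_ring D) (divK : is_subdivring K).

Definition central : {pred D} := fun z => `[< center_of K z >].

Fact central_divring_closed : divring_closed central.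
Proof.
case: divK => K1 KB KM KV.
split=> [|x y /asboolP[Kx cx] /asboolP[Ky cy]|x y /asboolP[Kx cx] /asboolP[Ky cy]];
  apply/asboolP.
- by split=> // y _; rewrite mul1r mulr1.
- by split=> [|z Kz]; [exact: KB | rewrite mulrBl mulrBr cx ?cy].
have [-> | y0] := eqVneq y 0.
  rewrite invr0 mulr0; split=> [|z _]; last by rewrite mul0r mulr0.
  by rewrite -(subrr 1); apply: KB.
split=> [|z Kz]; first by apply: KM => //; apply: KV.
have uy := divD y0.
rewrite mulrA -cx // -!mulrA; congr (_ * _).
by apply: (mulrI uy); rewrite mulVKr // mulrA cy // mulrK.
Qed.

HB.instance Definition _ :=
  GRing.isDivringClosed.Build D central central_divring_closed.

Record center_elt := CenterElt {ceval : D; _ : ceval \in central}.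

HB.instance Definition _ := [isSub for ceval].
HB.instance Definition _ := [Choice of center_elt by <:].
HB.instance Definition _ := [SubChoice_isSubUnitRing of center_elt by <:].

Fact center_elt_mulC : @commutative center_elt center_elt *%R.
Proof.
case=> x hx [y hy]; apply: val_inj => /=.
by have /asboolP[_ cx] := hx; apply: cx; have /asboolP[] := hy.
Qed.

HB.instance Definition _ :=
  GRing.PzRing_hasCommutativeMul.Build center_elt center_elt_mulC.

Fact center_elt_field : GRing.field_axiom center_elt.
Proof. by move=> x x0; apply: divD. Qed.

HB.instance Definition _ :=
  GRing.ComUnitRing_isField.Build center_elt center_elt_field.

Lemma exists_center_field : exists (k : fieldType) (phi : {rmorphism k -> D}),
  forall z, center_of K z <-> exists a, z = phi a.
Proof.
exists center_elt, val => z; split=> [/asboolP hz | [[a ha] ->]].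
  by exists (CenterElt hz).
exact/asboolP.
Qed.

End CenterField.

Lemma gen_divring_subdivring (D : unitRingType) (S : seq D) :
  is_subdivring (gen_divring S).
Proof.
split=> [K [] // | x y Sx Sy K divK KS | x y Sx Sy K divK KS | x Sx x0 K divK KS];
  have [_ KB KM KV] := divK.
- by apply: KB; [apply: Sx | apply: Sy].
- by apply: KM; [apply: Sx | apply: Sy].
- by apply: KV => //; apply: Sx.
Qed.

(** Left multiplication by an element of [K] is linear over the center and preserves [K], the span
    of the basis, which is nonempty because [K] contains 1. *)
Lemma fin_dim_basis (D : unitRingType) (K : D -> Prop) (k : fieldType)
    (phi : {rmorphism k -> D}) :
  is_subdivring K -> fin_dim_over_center K ->
  (forall z, center_of K z <-> exists a, z = phi a) ->
  exists n (b : 'I_n.+1 -> D), linfree phi b /\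
    forall z, K z -> exists M, represents phi b z M.
Proof.
move=> [K1 KB KM KV] [l [Kl span_l]] centerK.
have K0 : K 0 by rewrite -(subrr 1); apply: KB.
have KD u v : K u -> K v -> K (u + v).
  by move=> Ku Kv; rewrite -[v]opprK -(sub0r v); apply/KB/KB.
have cK z a : K z -> z * phi a = phi a * z.
  by move=> Kz; have /centerK[_ ->] : exists a', phi a = phi a' by exists a.
pose b0 (i : 'I_(size l)) := l`_i.
have span_b0 z : K z -> inspan phi b0 z.
  case/span_l=> c [szc centc ->]; apply: inspan_sum => i _.
  have /centerK[a ->] : center_of K c`_i by apply/centc/mem_nth; rewrite szc.
  exact/inspanZ/inspan_gen.
have b0K z : inspan phi b0 z -> K z.
  case=> v ->; apply: (big_ind K) => // i _; apply: KM; last exact/Kl/mem_nth.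
  by have [] : center_of K (phi (v 0 i)) by apply/centerK; exists (v 0 i).
have [[|n] [b [free_b spanE]]] := exists_linfree phi b0.
  have /spanE[v] := span_b0 1 K1; rewrite /lincomb big_ord0 => /eqP.
  by rewrite oner_eq0.
exists n, b; split=> // z Kz; apply: represents_exists => [a | i]; first exact: cK.
by apply/spanE/span_b0/KM/b0K/spanE/inspan_gen.
Qed.

(** * Contradiction from a noncommuting pair *)

Theorem theorem6p3 (D : unitRingType) :
  is_division_ring D ->
  weakly_locally_finite D ->
  (forall a b : D, a != 0 -> b != 0 ->
     exists n : nat, (0 < n)%N /\ center ((a * b * a^-1 * b^-1) ^+ n)) ->
  forall x y : D, x * y = y * x.
Proof.
move=> divD wlfD comD x y; apply/eqP/negPn/negP => nc.
pose K := gen_divring [:: x; y].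
have divK : is_subdivring K := gen_divring_subdivring _.
have [K1 KB KM KV] := divK.
have Kx : K x by move=> L _; apply; rewrite mem_head.
have Ky : K y by move=> L _; apply; rewrite inE mem_head orbT.
have [k [phi centerK]] := exists_center_field divD divK.
have [n [b [free_b repK]]] := fin_dim_basis divK (wlfD _) centerK.
have phiK t : center_of K (phi t) by apply/centerK; exists t.
have cK z t : K z -> z * phi t = phi t * z by move=> Kz; case: (phiK t) => _ ->.
have x0 : x != 0 by apply: contraNneq nc => ->; rewrite mul0r mulr0.
have torsion t : exists2 m, (0 < m)%N &
    (x * (phi t - y) * x^-1 * (phi t - y)^-1) ^+ m = 1.
  have z0 : phi t - y != 0.
    by apply: contra nc; rewrite subr_eq0 => /eqP<-; rewrite cK.
  have Kz : K (phi t - y) by apply: KB => //; case: (phiK t).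
  have [m [m_gt0 [_ cent]]] := comD _ _ x0 z0.
  set c := x * (phi t - y) * _ * _ in cent *.
  have Kc : K c := KM _ _ (KM _ _ (KM _ _ Kx Kz) (KV _ Kx x0)) (KV _ Kz z0).
  have Kcm : K (c ^+ m) by elim: (m) => // l IHl; rewrite exprS; apply: KM.
  (* An element of [K] central in [D] is central in [K], hence a scalar. *)
  have [f cf] : exists f, c ^+ m = phi f.
    by apply/centerK; split=> // z _; apply: cent.
  have [[X xX] [Z zZ]] := (repK _ Kx, repK _ Kz).
  exact: commutator_torsion divD free_b _ _ _ _ _ _ xX zZ x0 z0 m_gt0 cf.
have [[X xX] [Y yY]] := (repK _ Kx, repK _ Ky).
have [delta delta0 valk] := char_poly_values divD free_b xX yY nc.
have alg (P : fieldType) (iota : {rmorphism P -> k}) t : integralOver iota t.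
  apply: (integral_of_values (g := delta^-1 *: char_poly Y)).
    by rewrite size_scale ?invr_eq0 // size_char_poly.
  move=> r; have [w intw Dw] := valk r (cK _ _ Kx) (torsion r).
  have w0 : w != 0 by apply: contraNneq delta0 => w0; rewrite -Dw w0 mul0r.
  (* The value at [r] is [w^-1], and inverses of algebraic elements are algebraic. *)
  rewrite hornerZ -Dw invfM mulrVK ?unitfE //; last first.
    by apply: contraNneq delta0 => Y0; rewrite -Dw Y0 mulr0.
  exact/integral_inv/integral_over_int.
case: (prime_field_rmorphism k) => [[p [iota]] | [iota]].
  have [m [e [free_e [[X' xX'] [Y' yY']]]]] :=
    descend_basis free_b (alg _ iota) (fun t => cK _ t Kx) (fun t => cK _ t Ky) xX yY.
  by case/eqP: nc; apply: represents_finite_comm divD free_e _ _ _ _ xX' yY'.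
have [m [e [free_e [[X' xX'] [Y' yY']]]]] :=
  descend_basis free_b (alg _ iota) (fun t => cK _ t Kx) (fun t => cK _ t Ky) xX yY.
(* The torsion statement concerns elements of [D], so it serves again with rational scalars
   [phi (iota t)]. *)
have [d d0 valQ] := char_poly_values divD free_e xX' yY' nc.
(* At [l] the characteristic polynomial exceeds [|d|], yet [d] is that value times [w], and [|w|] is
   at least 1. *)
have [|l] := poly_rat_unbounded `|d| (char_poly_monic Y').
  by rewrite size_char_poly.
have [w intw Dw] := valQ l%:R (cK _ _ Kx) (torsion _).
have w0 : w != 0 by apply: contraNneq d0 => w0; rewrite -Dw w0 mul0r.
rewrite ltNge => /negP[]; rewrite -Dw normrM (le_trans (ler_norm _)) //.
by rewrite ler_peMl // integral_rat_norm_ge1.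
Qed.
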